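(* Let $M=M_{n_1}(\mathbb{F}_{q^{d_1}})\times\cdots\times M_{n_k}(\mathbb{F}_{q^{d_k}})$ be a finite-dimensional semisimple $\mathbb{F}_q$-algebra, let $\chi=(\chi_1,\ldots,\chi_k)$ be a multiplicative character of $M^\times$ of determinant type, and let $a\in\mathbb{F}_q^\times$. Let $B'=\mathbb{F}_{q^{d_1}}^{n_1}\times\cdots\times\mathbb{F}_{q^{d_k}}^{n_k}$, let $\eta$ be the character of $(B')^\times$ given by $\eta((x_{ij}))=\prod_{i=1}^k\prod_{j=1}^{n_i}\chi_i(x_{ij})$, and let $\nu\colon(B')^\times\to\mathbb{F}_q^\times$ be the norm map $\nu((x_{ij}))=\prod_i\mathrm{Norm}_{\mathbb{F}_{q^{d_i}}/\mathbb{F}_q}(x_{i1}\cdots x_{in_i})$. Put $N=\sum_{i=1}^k d_i\binom{n_i}{2}$, and let $\mathcal{B}_M$ be the product over $i$ of the groups of invertible upper triangular matrices in $\mathrm{GL}_{n_i}(\mathbb{F}_{q^{d_i}})$. Then: (1) If $\eta$ is nontrivial on $\ker(\nu)$, then $$\mathrm{IKl}_M(a;\chi)=q^N\,\mathrm{IKl}_{B'}(a;\eta).$$ (2) If $\eta$ is trivial on $\ker(\nu)$, equivalently if $\eta=\rho\circ\nu$ for some multiplicative character $\rho$ of $\mathbb{F}_q^\times$, then $$\mathrm{IKl}_M(a;\chi)=q^N\,\mathrm{IKl}_{B'}(a;\eta)-\rho(a)\frac{\#M^\times-\#\mathcal{B}_M}{q(q-1)}.$$ Equivalently, since $\#\mathcal{B}_M=q^N\#(B')^\times$,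 $$\mathrm{IKl}_M(a;\chi)+\rho(a)\frac{\#M^\times}{q(q-1)}=q^N\left(\mathrm{IKl}_{B'}(a;\eta)+\rho(a)\frac{\#(B')^\times}{q(q-1)}\right).$$
   Context: $\mathbb{F}_q$ is a finite field and $\psi\colon\mathbb{F}_q\to\mathbb{C}^\times$ is a fixed nontrivial additive character. Every finite-dimensional semisimple $\mathbb{F}_q$-algebra $M$ is isomorphic to a product $M_{n_1}(\mathbb{F}_{q^{d_1}})\times\cdots\times M_{n_k}(\mathbb{F}_{q^{d_k}})$ with $k,n_i,d_i\geq 1$, and is identified with such a product. Reduced norm and reduced trace: for $x=(A_1,\ldots,A_k)\in M$, $\mathrm{Nrd}(x)=\prod_{i=1}^k \mathrm{Norm}_{\mathbb{F}_{q^{d_i}}/\mathbb{F}_q}(\det A_i)\in\mathbb{F}_q$ and $\mathrm{Trd}(x)=\sum_{i=1}^k \mathrm{Tr}_{\mathbb{F}_{q^{d_i}}/\mathbb{F}_q}(\operatorname{Tr}A_i)\in\mathbb{F}_q$. A character $\chi\colon M^\times\to\mathbb{C}^\times$ is of determinant type if there are multiplicative characters $\chi_i\colon\mathbb{F}_{q^{d_i}}^\times\to\mathbb{C}^\times$ with $\chi(A_1,\ldots,A_k)=\prod_i\chi_i(\det A_i)$; one writes $\chi=(\chi_1,\ldots,\chi_k)$. For any finite-dimensional semisimple $\mathbb{F}_q$-algebra $M$, any multiplicative character $\chi\colon M^\times\to\mathbb{C}^\times$ and $a\in\mathbb{F}_q^\times$, the inverted Kloosterman sum is $$\mathrm{IKl}_M(a;\chi)=\sum_{x\in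 M^\times,\ \mathrm{Nrd}(x)=a,\ \mathrm{Trd}(x)\neq0}\chi(x)\,\psi\!\left(\frac{1}{\mathrm{Trd}(x)}\right).$$ This applies in particular to the commutative étale algebra $B'$ (a product of $1\times 1$ matrix algebras), whose elements are tuples $(x_{ij})_{1\le i\le k,\,1\le j\le n_i}$ with $x_{ij}\in\mathbb{F}_{q^{d_i}}$ (invertible iff all coordinates are nonzero), with reduced norm $\prod_{i}\mathrm{Norm}_{\mathbb{F}_{q^{d_i}}/\mathbb{F}_q}(x_{i1}\cdots x_{in_i})$ and reduced trace $\sum_{i}\mathrm{Tr}_{\mathbb{F}_{q^{d_i}}/\mathbb{F}_q}(x_{i1}+\cdots+x_{in_i})$. *)

(* Defs.v *)
From HB Require Import structures.
From mathcomp Require Import all_boot all_order all_algebra all_fingroup.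
From mathcomp Require Import all_solvable all_field.
From mathcomp Require Import reals complex.

Set Implicit Arguments.
Unset Strict Implicit.
Unset Printing Implicit Defensive.

Import GRing.Theory.
Local Open Scope ring_scope.

(* Field extensions of the finite field F are arbitrary [L : fieldExtType F]
   (finite-dimensional by definition, so L is a field with q ^ \dim L elements,
   q = #|F|).  [finvect_type L] is L itself, but with its canonical finite type
   and splitting field (over F) structures. *)

Section NormTrace.
Variables (F : finFieldType) (L : fieldExtType F).
Local Notation K := (finvect_type L).

(* [galNorm] and [galTrace] take values in K, in the image of F;
   [to_base] returns the corresponding element of F. *)
Definition to_base (y : K) : F := odflt 0 [pick c : F | c%:A == y].

Definition fnorm (x : K) : F := to_base (galNorm 1 {:K} x).
Definition ftrace (x : K) : F := to_base (galTrace 1 {:K} x).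

Lemma to_baseE (y : K) : y \in 1%VS -> (to_base y)%:A = y.
Proof.
move=> /vlineP[c ->]; rewrite /to_base.
by case: pickP => [b /eqP// | /(_ c)]; rewrite eqxx.
Qed.

Lemma galois_fin : galois 1 {:K}.
Proof. exact/finField_galois/subvf. Qed.

Lemma fnormE (x : K) : (fnorm x)%:A = galNorm 1 {:K} x.
Proof. by apply/to_baseE/mem_galNorm; rewrite ?galois_fin ?memvf. Qed.

Lemma ftraceE (x : K) : (ftrace x)%:A = galTrace 1 {:K} x.
Proof. by apply/to_baseE/mem_galTrace; rewrite ?galois_fin ?memvf. Qed.

End NormTrace.

Section Characters.
Variable C : fieldType.

(* These two conditions force psi to be nonzero everywhere:
   psi x * psi (- x) = psi 0 = 1. *)
Definition additive_char (F : finFieldType) (psi : F -> C) : Prop :=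
  psi 0 = 1 /\ {morph psi : x y / x + y >-> x * y}.

(* Characters K^* -> C^* are represented by functions on K whose value at 0
   is irrelevant; the conditions force nonzero values on K^*. *)
Definition mult_char (K : fieldType) (f : K -> C) : Prop :=
  f 1 = 1 /\ forall x y, x != 0 -> y != 0 -> f (x * y) = f x * f y.

End Characters.

(* The product over i : I of the matrix algebras M_{n i}(L i). *)
Definition ssalg (F : finFieldType) (I : finType) (L : I -> fieldExtType F)
    (n : I -> nat) : predArgType :=
  {dffun forall i : I, 'M[finvect_type (L i)]_(n i)}.

HB.instance Definition _ F I L n := Finite.on (@ssalg F I L n).

Section Semisimple.
Variables (F : finFieldType) (I : finType) (L : I -> fieldExtType F).
Variable n : I -> nat.
Local Notation M := (ssalg L n).

Definition ss1 : M := [ffun i => 1%:M].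
Definition ssmul (x y : M) : M := [ffun i => x i *m y i].

Definition ssunits : {set M} := [set x : M | [forall i, x i \in unitmx]].

Definition Nrd (x : M) : F := \prod_i fnorm (\det (x i)).
Definition Trd (x : M) : F := \sum_i ftrace (\tr (x i)).

(* [is_trig_mx] means lower triangular, hence the transpose. *)
Definition borel : {set M} :=
  [set x : M in ssunits | [forall i, is_trig_mx (x i)^T]].

Section InC.
Variable C : fieldType.

(* As above, only the values of chi on the units of M are relevant. *)
Definition ss_char (chi : M -> C) : Prop :=
  chi ss1 = 1 /\ {in ssunits &, {morph chi : x y / ssmul x y >-> x * y}}.

Definition det_type_with (chis : forall i, finvect_type (L i) -> C)
    (chi : M -> C) : Prop :=
  (forall i, mult_char (chis i)) /\
  {in ssunits, forall x, chi x = \prod_i chis i (\det (x i))}.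

Definition IKl (psi : F -> C) (a : F) (chi : M -> C) : C :=
  \sum_(x in ssunits | (Nrd x == a) && (Trd x != 0)) chi x * psi (Trd x)^-1.

End InC.
End Semisimple.

(* The commutative algebra B' = prod_i (L i)^(n i), as the product of copies of
   the 1 x 1 matrix algebra over L i indexed by the pairs (i, j), j < n i. *)
Definition etale_idx (I : finType) (n : I -> nat) : finType :=
  {i : I & 'I_(n i)}.

Definition etale (F : finFieldType) (I : finType) (L : I -> fieldExtType F)
    (n : I -> nat) : predArgType :=
  ssalg (fun p : etale_idx n => L (tag p)) (fun=> 1%N).

Section Etale.
Variables (F : finFieldType) (I : finType) (L : I -> fieldExtType F).
Variable n : I -> nat.
Local Notation B' := (etale L n).

Definition etale_coord (x : B') (i : I) (j : 'I_(n i)) : finvect_type (L i) :=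
  x (Tagged (fun i => 'I_(n i)) j) 0 0.

Definition etale_units : {set B'} := ssunits _ _.

Definition nu (x : B') : F :=
  \prod_i fnorm (\prod_(j < n i) etale_coord x j).

Definition eta (C : fieldType) (chis : forall i, finvect_type (L i) -> C)
    (x : B') : C :=
  \prod_i \prod_(j < n i) chis i (etale_coord x j).

Definition trivial_on_ker_nu (C : fieldType) (f : B' -> C) : Prop :=
  {in etale_units, forall x, nu x = 1 -> f x = 1}.

Definition factors_through_nu (C : fieldType) (f : B' -> C) (rho : F -> C)
    : Prop :=
  mult_char rho /\ {in etale_units, forall x, f x = rho (nu x)}.

End Etale.

(* Main.v *)
Require Import Defs.
From mathcomp Require Import all_boot all_order all_algebra all_fingroup.
From mathcomp Require Import all_solvable all_field.
From mathcomp Require Import reals complex.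

Set Implicit Arguments.
Unset Strict Implicit.
Unset Printing Implicit Defensive.

Import GRing.Theory Num.Theory.
Local Open Scope ring_scope.

(* Let U be the group of unipotent upper triangular elements of M, acting on
   the units of M by left multiplication, which changes neither Nrd nor chi. On
   the orbit of x the map (1 + v) |-> Trd ((1 + v) x) is affine in the strictly
   upper triangular v, and it is nonconstant as soon as x has a nonzero entry
   below the diagonal. So off the Borel subgroup Trd is equidistributed on each
   U-orbit, and since the sum of psi (1 / b) over b != 0 is -1, the units
   outside the Borel subgroup contribute -1/q times the sum of chi over those
   of reduced norm a. The Borel subgroup contributes q ^ N * IKl_B'(a; eta),
   because only the diagonal matters there. The remaining sum of chi is
   evaluated by translating by the diagonal torus, a copy of the units of B':
   it vanishes if eta is nontrivial on ker nu, and otherwise chi = rho \o Nrd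
   and Nrd is equidistributed over the nonzero elements of F. *)

(** * Roots of unity in a finite field *)

Lemma expf_card_pred (E : finFieldType) (x : E) : x != 0 -> x ^+ #|E|.-1 = 1.
Proof.
move=> x0; apply: (mulfI x0).
by rewrite -exprS mulr1 prednK ?expf_card // ltnW ?finNzRing_gt1.
Qed.

(** The nonzero elements are [#|E|.-1] distinct roots of unity of order dividing [#|E|.-1], enough
    to contain one of exact order. *)
Lemma finField_primitive_root (E : finFieldType) :
  exists z : E, (#|E|.-1).-primitive_root z.
Proof.
have card_pred : #|predC1 (0 : E)| = #|E|.-1 by rewrite (cardC1 (0 : E)).
have /hasP[z _ zP] : has (#|E|.-1).-primitive_root (enum (predC1 (0 : E))).
  apply: has_prim_root; rewrite ?enum_uniq //.
  - by rewrite -subn1 subn_gt0 finNzRing_gt1.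
  - apply/allP => x; rewrite mem_enum inE => x0.
    by rewrite unity_rootE expf_card_pred.
  - by rewrite -cardE card_pred.
by exists z.
Qed.

(** * Norm and trace of finite fields *)

Section NormTraceTheory.
Variables (F : finFieldType) (L : fieldExtType F).
Local Notation K := (finvect_type L).

Lemma card_finvect : #|K| = (#|F| ^ \dim {:L})%N.
Proof. by rewrite -(card_vspace {:K}) card_vspacef. Qed.

(** Identities in F can be checked in K, where [fnormE] and [ftraceE] give access to the Galois norm
    and trace. *)
Lemma scale1_inj : injective (fun c : F => c%:A : K).
Proof. exact: (fmorph_inj (in_alg K)). Qed.

Lemma ftraceD : {morph @ftrace F L : x y / x + y}.
Proof.
by move=> x y; apply: scale1_inj; rewrite /= scalerDl !ftraceE raddfD.
Qed.

Lemma ftraceZ (c : F) (x : K) : ftrace (c *: x) = c * ftrace x.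
Proof.
apply: scale1_inj; rewrite /= -scalerA !ftraceE /galTrace scaler_sumr.
by apply: eq_bigr => s _; rewrite linearZ.
Qed.

Lemma ftrace0 : ftrace (0 : K) = 0.
Proof. by rewrite -(scale0r 0) ftraceZ mul0r. Qed.

Lemma ftrace_sum (J : finType) (G : J -> K) :
  ftrace (\sum_j G j) = \sum_j ftrace (G j).
Proof. exact: (big_morph _ ftraceD ftrace0). Qed.

(** Linear independence of automorphisms gives an element of nonzero trace; its multiples by F reach
    every b. *)
Lemma ftrace_surj (b : F) : exists x : K, ftrace x = b.
Proof.
have [x _ nz] := @gal_independent_contra _ _ {:K}%AS
  [in 'Gal({:K} / 1)%g] (fun=> 1) 1%g (group1 _) (oner_neq0 _).
have tr_neq0 : galTrace 1 {:K} x != 0.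
  by move: nz; under eq_bigr do rewrite mul1r.
have trx_neq0 : ftrace x != 0.
  by apply: contraNneq tr_neq0 => tr0; rewrite -ftraceE tr0 scale0r.
by exists ((b / ftrace x) *: x); rewrite ftraceZ divfK.
Qed.

Lemma fnorm1 : fnorm (1 : K) = 1.
Proof. by apply: scale1_inj; rewrite /= fnormE galNorm1 scale1r. Qed.

Lemma fnormM : {morph @fnorm F L : x y / x * y}.
Proof.
move=> x y; apply: scale1_inj; rewrite /= -scalerA -[RHS]mulr_algl.
by rewrite !fnormE galNormM.
Qed.

Lemma fnorm_prod (J : finType) (G : J -> K) :
  fnorm (\prod_j G j) = \prod_j fnorm (G j).
Proof. exact: (big_morph _ fnormM fnorm1). Qed.

Lemma fnorm_eq0 (x : K) : (fnorm x == 0) = (x == 0).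
Proof.
by rewrite -(galNorm_eq0 1 {:K} x) -fnormE scaler_eq0 oner_eq0 orbF.
Qed.

(* For a generator g of the unit group, fnorm (g ^+ j) = 1 forces
   g ^+ j = b / b ^+ q by Hilbert 90, whence q - 1 divides j and fnorm g has
   full order q - 1. *)
Lemma fnorm_surj (b : F) : b != 0 -> exists2 x : K, x != 0 & fnorm x = b.
Proof.
move=> b0; have q1 := finNzRing_gt1 F; have K1 := finNzRing_gt1 K.
have [g gP] := finField_primitive_root K.
have g0 : g != 0.
  by rewrite (prim_root_eq0 gP) -lt0n -ltnS prednK // ltnW.
have [alpha genalpha alphaE] := finField_galois_generator (sub1v {:K}).
set m := (\sum_(i < \dim {:K}) #|F| ^ i)%N.
have cardKE : #|K|.-1 = (#|F|.-1 * m)%N by rewrite card_finvect predn_exp.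
have [e eP e_dvd] : {e | e.-primitive_root (fnorm g) & (e %| #|F|.-1)%N}.
  by apply: prim_order_exists; rewrite ?expf_card_pred ?fnorm_eq0 // -subn1 subn_gt0.
have eE : e = #|F|.-1.
  apply/eqP; rewrite eqn_dvd e_dvd /=.
  have : galNorm 1 {:K} (g ^+ e) == 1.
    rewrite galNormX -fnormE -(rmorphXn (in_alg K)) /= (prim_expr_order eP).
    by rewrite scale1r.
  case/(Hilbert's_theorem_90 genalpha (memvf _)) => y [_ y0].
  rewrite alphaE ?memvf // dimv1 expn1 => ge.
  have m_gt0 : (0 < m)%N.
    have : (0 < #|K|.-1)%N by rewrite -subn1 subn_gt0.
    by rewrite cardKE muln_gt0 => /andP[].
  (* Multiplied by m, the divisibility becomes [g ^+ (e * m) = 1], and [g ^+ e] is the inverse of a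
     power of exponent [#|F|.-1]. *)
  rewrite -(dvdn_pmul2r m_gt0) -cardKE (prim_order_dvd gP) exprM ge.
  have -> : y / y ^+ #|F| = (y ^+ #|F|.-1)^-1.
    by rewrite -{1}(prednK (ltnW q1)) exprS invfM mulrA divff ?mul1r.
  by rewrite exprVn -exprM -cardKE expf_card_pred ?invr1.
have /(prim_rootP eP)[i ->] : b ^+ e = 1 by rewrite eE expf_card_pred.
exists (g ^+ i); first exact: expf_neq0.
have fnormX j : fnorm (g ^+ j) = fnorm g ^+ j.
  by elim: j => [|j IH]; rewrite ?fnorm1 // !exprS fnormM IH.
exact: fnormX.
Qed.
End NormTraceTheory.

(** * Averaging over unipotent elements *)

(** Truncating lets v range over all of M in [unip v] below: every unipotent element occurs equally
    often, which is harmless in an average. *)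
Definition supper (E : fieldType) m (A : 'M[E]_m) : 'M[E]_m :=
  \matrix_(r, c) if (r < c)%N then A r c else 0.

Lemma supperD (E : fieldType) m : {morph @supper E m : A B / A + B}.
Proof.
by move=> A B; apply/matrixP => r c; rewrite !mxE; case: ifP; rewrite ?addr0.
Qed.

Section SemisimpleTheory.
Variables (F : finFieldType) (I : finType) (L : I -> fieldExtType F).
Variable n : I -> nat.
Local Notation M := (ssalg L n).
Implicit Types x y v w : M.

Lemma ssunitsP x : reflect (forall i, \det (x i) != 0) (x \in ssunits L n).
Proof.
rewrite inE; apply: (iffP forallP) => xU i; have := xU i;
  by rewrite unitmxE unitfE.
Qed.

Lemma det_ssmul x y i : \det (ssmul x y i) = \det (x i) * \det (y i).
Proof. by rewrite ffunE det_mulmx. Qed.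

Lemma ssmul_units x y : x \in ssunits L n -> y \in ssunits L n ->
  ssmul x y \in ssunits L n.
Proof.
move=> /ssunitsP xU /ssunitsP yU; apply/ssunitsP => i.
by rewrite det_ssmul mulf_neq0 ?xU ?yU.
Qed.

Lemma ssmul_unitsE x y : x \in ssunits L n ->
  (ssmul x y \in ssunits L n) = (y \in ssunits L n).
Proof.
move=> xU; apply/idP/idP => [/ssunitsP xyU|]; last exact: ssmul_units.
by apply/ssunitsP => i; have := xyU i; rewrite det_ssmul mulf_eq0 => /norP[].
Qed.

Lemma ssmul_inj x : x \in ssunits L n -> injective (ssmul x).
Proof.
rewrite inE => /forallP xU y z /ffunP eq_xyz; apply/ffunP => i.
by have := eq_xyz i; rewrite !ffunE => /(can_inj (mulKmx (xU i))).
Qed.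

Lemma NrdM x y : Nrd (ssmul x y) = Nrd x * Nrd y.
Proof.
by rewrite /Nrd -big_split /=; apply: eq_bigr => i _; rewrite det_ssmul fnormM.
Qed.

Lemma borelP x : reflect (forall i, \det (x i) != 0 /\
    forall r c : 'I_(n i), (c < r)%N -> x i r c = 0) (x \in borel L n).
Proof.
apply: (iffP setIdP) => [[/ssunitsP xU /forallP xT] i|xB].
  split=> // r c ltcr; have /is_trig_mxP/(_ c r ltcr) := xT i.
  by rewrite mxE.
split; first by apply/ssunitsP => i; have [] := xB i.
apply/forallP => i; apply/is_trig_mxP => r c ltrc; rewrite mxE.
by have [_ ->] := xB i.
Qed.

Lemma borel_units x : x \in borel L n -> x \in ssunits L n.
Proof. by case/setIdP. Qed.

Lemma ssmul_borel x y : x \in borel L n -> y \in borel L n ->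
  ssmul x y \in borel L n.
Proof.
move=> /borelP xB /borelP yB; apply/borelP => i; have [ux tx] := xB i.
have [uy ty] := yB i; split=> [|r c ltcr]; first by rewrite det_ssmul mulf_neq0.
rewrite ffunE mxE big1 // => j _; have [ltjr|lerj] := ltnP j r.
  by rewrite tx ?mul0r.
by rewrite ty ?mulr0 // (leq_trans ltcr).
Qed.

(* Left multiplication by x permutes the finite set of units and preserves the
   Borel subgroup, so it also preserves its complement. *)
Lemma ssmul_borelE x y : x \in borel L n ->
  (ssmul x y \in borel L n) = (y \in borel L n).
Proof.
move=> xB; apply/idP/idP; last exact: ssmul_borel.
have inj := ssmul_inj (borel_units xB).
have imE : borel L n = ssmul x @: borel L n.
  apply/esym/eqP; rewrite eqEcard card_imset // leqnn andbT.
  by apply/subsetP => _ /imsetP[z zB ->]; apply: ssmul_borel.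
by rewrite {1}imE mem_imset.
Qed.

Definition ssadd x y : M := [ffun i => x i + y i].

Lemma ssadd_inj x : injective (ssadd x).
Proof.
move=> y z /ffunP eq_xyz; apply/ffunP => i.
by have := eq_xyz i; rewrite !ffunE => /addrI.
Qed.

Definition unip v : M := [ffun i => 1%:M + supper (v i)].

Lemma det_unip v i : \det (unip v i) = 1.
Proof.
rewrite ffunE -det_tr det_trig.
  by rewrite big1 // => j _; rewrite !mxE eqxx ltnn addr0.
apply/is_trig_mxP => r c ltrc; rewrite !mxE ltnNge ltnW //= addr0.
by rewrite -val_eqE gtn_eqF.
Qed.

Lemma unip_borel v : unip v \in borel L n.
Proof.
apply/borelP => i; split=> [|r c ltcr]; first by rewrite det_unip oner_neq0.
by rewrite ffunE !mxE ltnNge ltnW //= addr0 -val_eqE gtn_eqF.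
Qed.

(** The linear part in v of the reduced trace along the unipotent orbit of x. *)
Definition trU x v : F := \sum_i ftrace (\tr (supper (v i) *m x i)).

Lemma Trd_unip x v : Trd (ssmul (unip v) x) = Trd x + trU x v.
Proof.
rewrite /Trd /trU -big_split /=; apply: eq_bigr => i _.
by rewrite !ffunE mulmxDl mul1mx mxtraceD ftraceD.
Qed.

Lemma Nrd_unip v : Nrd (unip v) = 1.
Proof. by rewrite /Nrd big1 // => i _; rewrite det_unip fnorm1. Qed.

Lemma trUD x v w : trU x (ssadd v w) = trU x v + trU x w.
Proof.
rewrite /trU -big_split /=; apply: eq_bigr => i _.
by rewrite !ffunE supperD mulmxDl mxtraceD ftraceD.
Qed.

Lemma trU_surj x (b : F) : x \in ssunits L n -> x \notin borel L n ->
  exists v, trU x v = b.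
Proof.
move=> xU xB.
have [i [r [c [ltrc xcr]]]] :
    exists i, exists r : 'I_(n i), exists c : 'I_(n i), (r < c)%N /\ x i c r != 0.
  have xT : ~~ [forall i, is_trig_mx (x i)^T] by move: xB; rewrite inE xU.
  have [i xiT] := forallPn xT; move: xiT.
  move=> /forallPn[r]; move=> /forallPn[c].
  rewrite negb_imply mxE => /andP[ltrc xcr].
  by exists i, r, c.
have [t tb] := ftrace_surj (L i) b.
(* Only the entry of [x i] at (c, r), below the diagonal, contributes to the trace of [A *m x i],
   which is therefore t. *)
pose A : 'M[finvect_type (L i)]_(n i) := (t / x i c r) *: delta_mx r c.
exists [ffun j => dfwith (fun j => 0 : 'M[finvect_type (L j)]_(n j)) A j].
have supper0 j : supper (0 : 'M[finvect_type (L j)]_(n j)) = 0.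
  by apply/matrixP => r' c'; rewrite !mxE if_same.
rewrite /trU (bigD1 i) //= [X in _ + X]big1 ?addr0 => [|j neij]; last first.
  by rewrite ffunE dfwith_out ?(eq_sym i) // supper0 mul0mx mxtrace0 ftrace0.
rewrite ffunE dfwith_in -tb; congr ftrace.
have -> : supper A = A.
  apply/matrixP => r' c'; rewrite !mxE; case: ifP => //.
  by case: eqP => [->|]; case: eqP => [->|]; rewrite ?ltrc ?mulr0.
rewrite -scalemxAl mxtraceZ /mxtrace (bigD1 r) //= big1 => [|j nejr].
  rewrite addr0 mxE (bigD1 c) //= big1 => [|j nejc].
    by rewrite addr0 !mxE !eqxx mul1r divfK.
  by rewrite mxE eqxx (negPf nejc) mul0r.
by rewrite mxE big1 // => k _; rewrite mxE (negPf nejr) mul0r.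
Qed.

(** * Sums over the units outside the Borel subgroup *)

Section Sums.
Variables (C : numFieldType).

(** By [trU_surj], translating v shifts the reduced trace by any prescribed b without changing the
    sum; summing over b makes the argument of f run over all of F. *)
Lemma sum_Trd_unip x (f : F -> C) : x \in ssunits L n -> x \notin borel L n ->
  #|F|%:R * (\sum_v f (Trd (ssmul (unip v) x))) = #|M|%:R * \sum_b f b.
Proof.
move=> xU xB.
have shift b : \sum_v f (Trd (ssmul (unip v) x))
             = \sum_v f (Trd (ssmul (unip v) x) + b).
  have [w <-] := trU_surj b xU xB.
  rewrite (reindex_inj (@ssadd_inj w)); apply: eq_bigr => v _.
  by rewrite !Trd_unip trUD addrA addrAC.
have -> : #|F|%:R * (\sum_v f (Trd (ssmul (unip v) x)))
        = \sum_b \sum_v f (Trd (ssmul (unip v) x) + b).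
  rewrite mulr_natl -sumr_const; apply: eq_bigr => b _; exact: shift.
rewrite exchange_big mulr_natl -sumr_const; apply: eq_bigr => v _.
by rewrite [RHS](reindex_inj (addrI (Trd (ssmul (unip v) x)))).
Qed.

(** Translation by [unip v] preserves the range of summation and chi, so the sum equals its average
    over v, which [sum_Trd_unip] evaluates term by term. *)
Lemma sum_nonborel (chi : M -> C) (f : F -> C) (a : F) :
  (forall v, {in ssunits L n, forall x, chi (ssmul (unip v) x) = chi x}) ->
  #|F|%:R * (\sum_(x in ssunits L n :\: borel L n | Nrd x == a)
               chi x * f (Trd x))
  = (\sum_(x in ssunits L n :\: borel L n | Nrd x == a) chi x) * \sum_b f b.
Proof.
move=> chiU; have M0 : #|M|%:R != 0 :> C.
  by rewrite pnatr_eq0 -lt0n; apply/card_gt0P; exists (ss1 L n).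
apply: (mulfI M0); set S := \sum_(x in _ | _) (_ * _).
have shift v : S = \sum_(x in ssunits L n :\: borel L n | Nrd x == a)
                 chi x * f (Trd (ssmul (unip v) x)).
  have uU := borel_units (unip_borel v).
  rewrite /S (reindex_inj (ssmul_inj uU)); apply: eq_big => [x|x].
    by rewrite !in_setD ssmul_borelE ?unip_borel // ssmul_unitsE // NrdM
      Nrd_unip mul1r.
  by rewrite !in_setD ssmul_unitsE // => /andP[/andP[_ xU] _]; rewrite chiU.
have SE : #|M|%:R * S =
    \sum_v \sum_(x in ssunits L n :\: borel L n | Nrd x == a)
      chi x * f (Trd (ssmul (unip v) x)).
  by rewrite mulr_natl -sumr_const; apply: eq_bigr => v _; apply: shift.
rewrite mulrCA SE.
rewrite exchange_big /= mulr_sumr mulr_suml mulr_sumr; apply: eq_bigr => x.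
case/andP => /setDP[xU xB] _.
by rewrite -mulr_sumr mulrCA sum_Trd_unip // mulrCA.
Qed.
End Sums.
End SemisimpleTheory.

(** * Borel subgroup and diagonal *)

(** Column c has c free entries, those above the diagonal, and the integers below m add up to
    ['C(m, 2)]. *)
Lemma card_upper_diag (E : finFieldType) m (d : 'I_m -> E) :
  #|[set A : 'M[E]_m | [forall r : 'I__, forall c : 'I_m,
       ((c < r)%N ==> (A r c == 0)) && ((r == c) ==> (A r c == d r))]]|
  = (#|E| ^ 'C(m, 2))%N.
Proof.
(* With matrices seen as functions on pairs of indices, the constraints are entrywise and the
   cardinal becomes a product over the entries. *)
pose G (p : 'I_m * 'I_m) : pred E :=
  if (p.1 < p.2)%N then predT
  else if p.1 == p.2 then pred1 (d p.1) else pred1 0.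
pose f (g : {ffun 'I_m * 'I_m -> E}) : 'M[E]_m := \matrix_(r, c) g (r, c).
have f_inj : injective f.
  move=> g h /matrixP eq_gh; apply/ffunP => -[r c].
  by have := eq_gh r c; rewrite !mxE.
set S := [set A | _].
have -> : S = f @: [set g in family G].
  apply/setP => A; apply/idP/imsetP => [|[g]]; rewrite inE.
    move=> /'forall_forallP HA; exists [ffun p => A p.1 p.2]; last first.
      by apply/matrixP => r c; rewrite mxE ffunE.
    rewrite inE; apply/familyP => -[r c]; rewrite ffunE /G /=.
    have := HA r c; case: ltngtP => //= [|/val_inj <-].
      by move=> ltcr /andP[/eqP -> _]; rewrite -val_eqE gtn_eqF // inE.
    by rewrite eqxx inE.
  move/familyP => gG ->; rewrite inE; apply/'forall_forallP => r c; rewrite !mxE.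
  have := gG (r, c); rewrite /G /=; case: ltngtP => //= [ltrc _|ltcr|/val_inj <-].
  - by rewrite -val_eqE ltn_eqF.
  - by rewrite -val_eqE gtn_eqF // andbT.
  - by rewrite eqxx inE.
rewrite card_imset // cardsE card_family foldrE big_image /=.
rewrite -(pair_bigA _ (fun r c => #|G (r, c)|)) exchange_big /=.
transitivity (\prod_(c < m) #|E| ^ c)%N; last first.
  by rewrite -expn_sum -bin2_sum big_mkord.
apply: eq_bigr => c _.
rewrite (eq_bigr (fun r : 'I_m => if (r < c)%N then #|E| else 1%N)) => [|r _].
  rewrite -big_mkcond /= -(big_ord_widen m (fun=> #|E|) (ltnW (ltn_ord c))).
  by rewrite prod_nat_const card_ord.
by rewrite /G /=; case: ifP => // _; case: ifP => _; rewrite ?card1 //.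
Qed.

Section EtaleTheory.
Variables (F : finFieldType) (I : finType) (L : I -> fieldExtType F).
Variable n : I -> nat.
Local Notation M := (ssalg L n).
Local Notation B' := (etale L n).
Implicit Types (x : M) (y z : B').

Lemma big_etale_idx (T : Type) (idx : T) (op : Monoid.com_law idx)
    (G : forall i, 'I_(n i) -> T) :
  \big[op/idx]_(p : etale_idx n) G (tag p) (tagged p)
  = \big[op/idx]_i \big[op/idx]_(j < n i) G i j.
Proof. by rewrite (sig_big_dep xpredT (fun=> xpredT)). Qed.

Lemma etale_coordE y (p : etale_idx n) : y p 0 0 = etale_coord y (tagged p).
Proof. by case: p. Qed.

Lemma etale_unitsP y :
  reflect (forall i (j : 'I_(n i)), etale_coord y j != 0) (y \in etale_units L n).
Proof.
apply: (iffP (ssunitsP _)) => [yU i j|yU p].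
  by have := yU (Tagged (fun i => 'I_(n i)) j); rewrite det_mx11.
by rewrite det_mx11 etale_coordE; apply: yU.
Qed.

Lemma Trd_etale y : Trd y = \sum_i ftrace (\sum_(j < n i) etale_coord y j).
Proof.
under [RHS]eq_bigr do rewrite ftrace_sum.
rewrite -(big_etale_idx _ (fun i j => ftrace (etale_coord y j))).
by apply: eq_bigr => p _; rewrite trace_mx11 etale_coordE.
Qed.

Lemma Nrd_etale y : Nrd y = nu y.
Proof.
rewrite /nu; under [RHS]eq_bigr do rewrite fnorm_prod.
rewrite -(big_etale_idx _ (fun i j => fnorm (etale_coord y j))).
by apply: eq_bigr => p _; rewrite det_mx11 etale_coordE.
Qed.

Definition etale_of (g : forall i, 'I_(n i) -> finvect_type (L i)) : B' :=
  [ffun p : etale_idx n => (g (tag p) (tagged p))%:M].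

Lemma etale_ofE g i (j : 'I_(n i)) : etale_coord (etale_of g) j = g i j.
Proof. by rewrite /etale_coord ffunE mxE mulr1n. Qed.

Lemma etaleP y z :
  (forall i (j : 'I_(n i)), etale_coord y j = etale_coord z j) -> y = z.
Proof.
move=> eq_yz; apply/ffunP => p; apply/matrixP => r c.
by rewrite !ord1 !etale_coordE.
Qed.

Definition borel_diag x : B' := etale_of (fun i j => x i j j).

Lemma Trd_borel_diag x : Trd (borel_diag x) = Trd x.
Proof.
rewrite Trd_etale; apply: eq_bigr => i _; congr ftrace.
by apply: eq_bigr => j _; rewrite etale_ofE.
Qed.

Lemma det_borel x i : x \in borel L n ->
  \det (x i) = \prod_(j < n i) etale_coord (borel_diag x) j.
Proof.
case/setIdP => _ /forallP xT; rewrite -det_tr det_trig ?xT //.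
by apply: eq_bigr => j _; rewrite mxE etale_ofE.
Qed.

Lemma Nrd_borel_diag x : x \in borel L n -> Nrd (borel_diag x) = Nrd x.
Proof.
by move=> xB; rewrite Nrd_etale; apply: eq_bigr => i _; rewrite det_borel.
Qed.

Lemma borel_diag_units x : x \in borel L n -> borel_diag x \in etale_units L n.
Proof.
move=> xB; apply/etale_unitsP => i j; have /ssunitsP/(_ i) := borel_units xB.
by rewrite det_borel // => /prodf_neq0/(_ j isT).
Qed.

(** The fibre is a product over i of sets of upper triangular matrices with prescribed diagonal,
    counted by [card_upper_diag]. *)
Lemma card_borel_diag y : y \in etale_units L n ->
  #|[set x in borel L n | borel_diag x == y]|
  = (#|F| ^ (\sum_i \dim {:L i} * 'C(n i, 2)))%N.
Proof.
move=> /etale_unitsP yU.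
pose S i := [set A : 'M[finvect_type (L i)]_(n i) |
  [forall r : 'I__, forall c : 'I_(n i), ((c < r)%N ==> (A r c == 0)) &&
     ((r == c) ==> (A r c == etale_coord y r))]].
have -> : [set x in borel L n | borel_diag x == y] = setXn S.
  apply/setP => x; rewrite inE; apply/andP/setXnP => [[xB /eqP xy] i|xS].
    rewrite inE; apply/'forall_forallP => r c; have /borelP/(_ i)[_ xT] := xB.
    apply/andP; split; apply/implyP; [by move=> ltcr; rewrite xT |].
    by move=> /eqP <-; rewrite -xy etale_ofE.
  have xS' i (r c : 'I_(n i)) : ((c < r)%N ==> (x i r c == 0)) &&
     ((r == c) ==> (x i r c == etale_coord y r)).
    by have := xS i; rewrite inE => /'forall_forallP.
  have xT i (r c : 'I_(n i)) : (c < r)%N -> x i r c = 0.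
    by move=> ltcr; have /andP[/implyP/(_ ltcr)/eqP] := xS' i r c.
  have xD i (r : 'I_(n i)) : x i r r = etale_coord y r.
    by have /andP[_ /implyP/(_ (eqxx r))/eqP] := xS' i r r.
  split; last by apply/eqP/etaleP => i j; rewrite etale_ofE.
  apply/borelP => i; split; last exact: xT.
  (* Invertibility is automatic: the determinant is a product of coordinates of the unit y. *)
  rewrite -det_tr det_trig; last first.
    by apply/is_trig_mxP => r c ltrc; rewrite mxE xT.
  by apply/prodf_neq0 => j _; rewrite mxE xD yU.
rewrite cardsXn expn_sum; apply: eq_bigr => i _.
by rewrite card_upper_diag card_finvect expnM.
Qed.

(** All fibres of [borel_diag] over units have the same size. Allowing a semiring covers [nat],
    where [G = 1] gives the order of the Borel subgroup. *)
Lemma sum_borel_diag (C : nzSemiRingType) (G : B' -> C) :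
  \sum_(x in borel L n) G (borel_diag x)
  = #|F|%:R ^+ (\sum_i \dim {:L i} * 'C(n i, 2)) * \sum_(y in etale_units L n) G y.
Proof.
rewrite (partition_big borel_diag [in etale_units L n]) /=; last first.
  exact: borel_diag_units.
rewrite mulr_sumr; apply: eq_bigr => y yU.
rewrite (eq_bigr (fun=> G y)) => [|x /andP[_ /eqP->] //].
rewrite sumr_const -natrX mulr_natl -(card_borel_diag yU).
by congr (_ *+ _); apply: eq_card => x; rewrite [RHS]inE.
Qed.

Lemma card_borel :
  #|borel L n| = (#|F| ^ (\sum_i \dim {:L i} * 'C(n i, 2)) * #|etale_units L n|)%N.
Proof.
rewrite -sum1_card -[#|etale_units L n|]sum1_card.
by rewrite (sum_borel_diag (fun=> 1%N : nat)) /= natrXE natn.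
Qed.

End EtaleTheory.

(** * Characters of determinant type *)

Lemma mult_char_prod (C K : fieldType) (f : K -> C) m (g : 'I_m -> K) :
  mult_char f -> (forall j, g j != 0) -> f (\prod_j g j) = \prod_j f (g j).
Proof.
move=> [f1 fM] g0.
(* The induction carries nonvanishing along, since f is multiplicative only at nonzero arguments. *)
have [//] : \prod_j g j != 0 /\ f (\prod_j g j) = \prod_j f (g j).
apply: (big_rec2 (fun u v => u != 0 /\ f u = v)); first by rewrite oner_neq0.
by move=> j u v _ [v0 <-]; rewrite mulf_neq0 ?fM.
Qed.

Section EtaleCharacters.
Variables (F : finFieldType) (I : finType) (L : I -> fieldExtType F).
Variable n : I -> nat.
Local Notation M := (ssalg L n).
Local Notation B' := (etale L n).
Implicit Types (x : M) (y z : B').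

Lemma etale_coordM y z i (j : 'I_(n i)) :
  etale_coord (ssmul y z) j = etale_coord y j * etale_coord z j.
Proof. by rewrite /etale_coord ffunE mxE big_ord1. Qed.

Lemma etale_coord1 i (j : 'I_(n i)) : etale_coord (ss1 _ _ : B') j = 1.
Proof. by rewrite /etale_coord ffunE mxE. Qed.

Lemma nuM y z : nu (ssmul y z) = nu y * nu z.
Proof. by rewrite -!Nrd_etale NrdM. Qed.

Lemma nu1 : nu (ss1 _ _ : B') = 1.
Proof.
by rewrite /nu big1 // => i _; rewrite big1 ?fnorm1 // => j _; rewrite etale_coord1.
Qed.

Lemma nu_neq0 y : y \in etale_units L n -> nu y != 0.
Proof.
move=> /etale_unitsP yU; apply/prodf_neq0 => i _; rewrite fnorm_eq0.
by apply/prodf_neq0 => j _; apply: yU.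
Qed.

Definition torus y : M := [ffun i => diag_mx (\row_j etale_coord y j)].

Lemma det_torus y i : \det (torus y i) = \prod_(j < n i) etale_coord y j.
Proof. by rewrite ffunE det_diag; apply: eq_bigr => j _; rewrite mxE. Qed.

Lemma Nrd_torus y : Nrd (torus y) = nu y.
Proof. by apply: eq_bigr => i _; rewrite det_torus. Qed.

Lemma torus_borel y : y \in etale_units L n -> torus y \in borel L n.
Proof.
move=> /etale_unitsP yU; apply/borelP => i; rewrite det_torus; split.
  by apply/prodf_neq0 => j _; apply: yU.
by move=> r c ltcr; rewrite ffunE !mxE -val_eqE gtn_eqF.
Qed.

(** Left translation by [torus y] preserves the complement of the Borel subgroup and multiplies
    [Nrd] by [nu y]. It serves with [nu y = 1] for vanishing and with [nu y = c / a] for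
    equidistribution. *)
Lemma sum_nonborel_torus (V : nmodType) y (c : F) (G : M -> V) :
  y \in etale_units L n ->
  \sum_(x in ssunits L n :\: borel L n | Nrd x == nu y * c) G x
  = \sum_(x in ssunits L n :\: borel L n | Nrd x == c) G (ssmul (torus y) x).
Proof.
move=> yU; have tB := torus_borel yU; have tU := borel_units tB.
rewrite (reindex_inj (ssmul_inj tU)); apply: eq_bigl => x.
rewrite !in_setD ssmul_borelE // ssmul_unitsE // NrdM Nrd_torus.
by rewrite (inj_eq (mulfI (nu_neq0 yU))).
Qed.

Section Characters.
Variables (C : numFieldType) (chis : forall i, finvect_type (L i) -> C).
Arguments chis : clear implicits.
Hypothesis chisP : forall i, mult_char (chis i).
Local Notation etac := (eta (n := n) chis).

Lemma etaM y z : y \in etale_units L n -> z \in etale_units L n ->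
  etac (ssmul y z) = etac y * etac z.
Proof.
move=> /etale_unitsP yU /etale_unitsP zU; rewrite /eta -big_split /=.
apply: eq_bigr => i _; rewrite -big_split /=; apply: eq_bigr => j _.
by rewrite etale_coordM; have [_ ->] := chisP i; rewrite ?yU ?zU.
Qed.

Lemma eta1 : etac (ss1 _ _) = 1.
Proof.
rewrite /eta big1 // => i _; rewrite big1 // => j _.
by rewrite etale_coord1; have [] := chisP i.
Qed.

Lemma prod_eta y : y \in etale_units L n ->
  \prod_i chis i (\prod_(j < n i) etale_coord y j) = etac y.
Proof.
move=> /etale_unitsP yU; apply: eq_bigr => i _.
by rewrite mult_char_prod // => j; apply: yU.
Qed.

(** * Surjectivity of the norm map and descent of eta *)

Hypothesis n_gt0 : forall i, (0 < n i)%N.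

(** A simple element of B' whose product of coordinates in block i is [t i]. Taking the determinants
    of x for t turns [Nrd x] and [chi x] into values of [nu] and [eta]. *)
Definition first_coord (t : forall i, finvect_type (L i)) : B' :=
  etale_of (fun i (j : 'I_(n i)) => if val j == 0%N then t i else 1).

Lemma prod_first_coord t i : \prod_(j < n i) etale_coord (first_coord t) j = t i.
Proof.
rewrite (bigD1 (Ordinal (n_gt0 i))) //= etale_ofE /= big1 ?mulr1 // => j.
by rewrite -val_eqE /= etale_ofE => /negPf->.
Qed.

Lemma first_coord_units t : (forall i, t i != 0) ->
  first_coord t \in etale_units L n.
Proof.
move=> t0; apply/etale_unitsP => i j; rewrite etale_ofE.
by case: ifP => _; rewrite ?t0 ?oner_neq0.
Qed.

Lemma nu_first_coord t : nu (first_coord t) = \prod_i fnorm (t i).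
Proof. by apply: eq_bigr => i _; rewrite prod_first_coord. Qed.

Lemma eta_first_coord t : (forall i, t i != 0) ->
  etac (first_coord t) = \prod_i chis i (t i).
Proof.
move=> t0; rewrite -prod_eta ?first_coord_units //.
by apply: eq_bigr => i _; rewrite prod_first_coord.
Qed.

(** The field norm of the factor [i0] is already surjective; the other factors are set to 1. *)
Lemma nu_surj (i0 : I) (b : F) : b != 0 ->
  exists2 y, y \in etale_units L n & nu y = b.
Proof.
move=> b0; have [z z0 zb] := fnorm_surj (L i0) b0.
pose t := dfwith (fun i => 1 : finvect_type (L i)) z.
exists (first_coord t).
  by apply: first_coord_units => i; rewrite /t; case: dfwithP => // *; apply: oner_neq0.
rewrite nu_first_coord (bigD1 i0) //= /t dfwith_in zb big1 ?mulr1 // => i nei.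
by rewrite dfwith_out 1?eq_sym // fnorm1.
Qed.

Lemma trivial_on_ker_nuP (i0 : I) :
  trivial_on_ker_nu etac <-> exists rho, factors_through_nu etac rho.
Proof.
split=> [triv|[rho [[rho1 _] etaE]] y yU nuy]; last by rewrite etaE // nuy.
have eta_nu y z : y \in etale_units L n -> z \in etale_units L n ->
    nu y = nu z -> etac y = etac z.
  move=> yU zU eq_nu; have /etale_unitsP yU' := yU; have /etale_unitsP zU' := zU.
  (* The coordinatewise quotient of y by z lies in the kernel of [nu]. *)
  pose w : B' := etale_of (fun i j => etale_coord y j / etale_coord z j).
  have wU : w \in etale_units L n.
    by apply/etale_unitsP => i j; rewrite etale_ofE mulf_neq0 ?invr_eq0 ?yU' ?zU'.
  have yE : y = ssmul w z.
    by apply: etaleP => i j; rewrite etale_coordM etale_ofE divfK ?zU'.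
  rewrite yE etaM // triv ?mul1r //; apply: (mulIf (nu_neq0 zU)).
  by rewrite mul1r -nuM -yE.
(* The value of [eta] at any preimage of c; the default 0 is taken only at [c = 0], by [nu_surj] and
   [nu_neq0]. *)
pose rho c :=
  if [pick y in etale_units L n | nu y == c] is Some y then etac y else 0.
have rhoE y : y \in etale_units L n -> etac y = rho (nu y).
  move=> yU; rewrite /rho; case: pickP => [z /andP[zU /eqP nuz]|/(_ y)].
    exact: eta_nu.
  by rewrite yU eqxx.
have oneU : (ss1 _ _ : B') \in etale_units L n.
  by apply/etale_unitsP => i j; rewrite etale_coord1 oner_neq0.
exists rho; split=> //; split; first by rewrite -nu1 -rhoE ?eta1.
move=> b c b0 c0; have [y yU <-] := nu_surj i0 b0; have [z zU <-] := nu_surj i0 c0.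
by rewrite -nuM -!rhoE ?etaM // ssmul_units.
Qed.

Variable chi : M -> C.
Hypothesis chiP : {in ssunits L n, forall x, chi x = \prod_i chis i (\det (x i))}.

Lemma chi_first_coord x : x \in ssunits L n ->
  let y := first_coord (fun i => \det (x i)) in
  [/\ y \in etale_units L n, nu y = Nrd x & etac y = chi x].
Proof.
move=> xU y; have /ssunitsP dx := xU.
by rewrite first_coord_units // nu_first_coord eta_first_coord // chiP.
Qed.

Lemma chi_torus y x : y \in etale_units L n -> x \in ssunits L n ->
  chi (ssmul (torus y) x) = etac y * chi x.
Proof.
move=> yU xU; have tU := borel_units (torus_borel yU).
rewrite !chiP ?ssmul_units // -prod_eta // -big_split /=.
apply: eq_bigr => i _; rewrite det_ssmul -det_torus.
by have [_ ->] := chisP i => //; apply/ssunitsP.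
Qed.

Lemma chi_unip v x : x \in ssunits L n -> chi (ssmul (unip v) x) = chi x.
Proof.
move=> xU; have vU := borel_units (unip_borel v); rewrite !chiP ?ssmul_units //.
by apply: eq_bigr => i _; rewrite det_ssmul det_unip mul1r.
Qed.

Lemma chi_borel x : x \in borel L n -> chi x = etac (borel_diag x).
Proof.
move=> xB; rewrite chiP ?borel_units // -prod_eta ?borel_diag_units //.
by apply: eq_bigr => i _; rewrite det_borel.
Qed.

(** * Evaluation of the inverted Kloosterman sum *)

Variable psi : F -> C.
Hypothesis psiP : additive_char psi.
Hypothesis psi_nontriv : exists t, psi t != 1.

Lemma sum_additive_char : \sum_b psi b = 0.
Proof.
have [psi0 psiD] := psiP; have [t psit] := psi_nontriv.
have : psi t * \sum_b psi b = \sum_b psi b.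
  by rewrite mulr_sumr [RHS](reindex_inj (addrI t)); apply: eq_bigr => b _; rewrite psiD.
move/eqP; rewrite -subr_eq0 -{2}[\sum_b _]mul1r -mulrBl mulf_eq0 subr_eq0.
by rewrite (negPf psit) => /eqP.
Qed.

(** Inversion permutes the nonzero elements, so this is the full sum of psi, which is 0, minus
    [psi 0 = 1]. *)
Lemma sum_psi_inv : \sum_(b | b != 0) psi b^-1 = -1.
Proof.
have [psi0 _] := psiP; have := sum_additive_char.
rewrite (bigD1 0) //= psi0 => /eqP; rewrite addrC addr_eq0 => /eqP <-.
by rewrite (reindex_inj invr_inj) /=; apply: eq_big => b; rewrite ?invr_eq0 ?invrK.
Qed.

Local Notation q := (#|F|%:R : C).
Local Notation N := (\sum_i \dim {:L i} * 'C(n i, 2))%N.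

Lemma card_field_neq0 : q != 0.
Proof. by rewrite pnatr_eq0 -lt0n; apply/card_gt0P; exists 0. Qed.

Lemma IKl_borel (a : F) :
  IKl psi a chi = q ^+ N * IKl psi a etac
    - q^-1 * \sum_(x in ssunits L n :\: borel L n | Nrd x == a) chi x.
Proof.
(* The condition on [Trd] moves into the summand. The value at 0 must be forced, since [0^-1 = 0]
   would give [psi 0 = 1]. *)
pose f (b : F) : C := if b != 0 then psi b^-1 else 0.
have IKlE :
      IKl psi a chi = \sum_(x in ssunits L n | Nrd x == a) chi x * f (Trd x).
  rewrite /IKl [RHS]big_mkcondr [LHS]big_mkcondr; apply: eq_bigr => x _ /=.
  by rewrite /f; case: eqP => //= _; case: eqP => //=; rewrite mulr0.
rewrite IKlE (big_setIDcond _ _ (borel L n)) /=; congr (_ + _).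
  have -> : ssunits L n :&: borel L n = borel L n.
    by apply/setIidPr/subsetP => x; apply: borel_units.
  rewrite big_mkcondr /= /IKl big_mkcondr /= -sum_borel_diag.
  apply: eq_bigr => x xB; rewrite Nrd_borel_diag // Trd_borel_diag chi_borel // /f.
  by case: eqP => //= _; case: eqP => //=; rewrite mulr0.
apply: (mulfI card_field_neq0); rewrite mulrN mulVKf ?card_field_neq0 //.
rewrite (sum_nonborel f a chi_unip) /f -big_mkcond sum_psi_inv mulrN1 //.
Qed.

Lemma sum_nonborel_eq0 (a : F) : ~ trivial_on_ker_nu etac ->
  \sum_(x in ssunits L n :\: borel L n | Nrd x == a) chi x = 0.
Proof.
move=> ntriv.
(* As B' is finite, the search for a witness is decidable, so the negated universal statement yields
   one constructively. *)
have [y [yU nuy etay]] :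
    exists y, [/\ y \in etale_units L n, nu y = 1 & etac y != 1].
  have [/existsP[y /and3P[yU /eqP nuy etay]]|none] :=
    boolP [exists y : B', [&& y \in etale_units L n, nu y == 1 & etac y != 1]].
    by exists y.
  case: ntriv => y yU nuy; apply/eqP; apply: contraNT none => etay.
  by apply/existsP; exists y; rewrite yU nuy eqxx.
set S := \sum_(x in _ | _) _.
(* Translation by [torus y] fixes the range of summation because [nu y = 1], and multiplies chi by
   [etac y], which differs from 1. *)
have : S = etac y * S.
  rewrite {1}/S -(mul1r a) -nuy sum_nonborel_torus // mulr_sumr.
  by apply: eq_bigr => x /andP[/setDP[xU _] _]; rewrite chi_torus.
move/eqP; rewrite -subr_eq0 -{1}[S]mul1r -mulrBl mulf_eq0 subr_eq0 eq_sym.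
by rewrite (negPf etay) => /eqP.
Qed.

(** A torus element of norm [c / a] carries the fibre of [Nrd] over a to the fibre over c, so the
    [#|F|.-1] fibres are equally large. *)
Lemma card_nonborel_Nrd (i0 : I) (a : F) : a != 0 ->
  #|ssunits L n :\: borel L n|
  = ((#|F|).-1 * \sum_(x in ssunits L n :\: borel L n | Nrd x == a) 1)%N.
Proof.
move=> a0; rewrite -sum1_card (partition_big (@Nrd F I L n) (predC1 0)) /=; last first.
  move=> x /setDP[xU _]; have [_ <- _] := chi_first_coord xU.
  by apply: nu_neq0; have [] := chi_first_coord xU.
rewrite -(cardC1 (0 : F)) -sum_nat_const; apply: eq_bigr => c c0.
have [y yU nuy] := nu_surj i0 (mulf_neq0 c0 (invr_neq0 a0)).
by rewrite -(divfK a0 c) -nuy sum_nonborel_torus.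
Qed.

(** Here chi is rho composed with [Nrd] on the units, hence constant on the sum, and
    [card_nonborel_Nrd] counts the terms. *)
Lemma sum_nonborel_factor (i0 : I) (a : F) rho : a != 0 ->
  factors_through_nu etac rho ->
  \sum_(x in ssunits L n :\: borel L n | Nrd x == a) chi x
  = rho a * ((#|ssunits L n|%:R - #|borel L n|%:R) / (q - 1)).
Proof.
move=> a0 [_ etaE].
have q1 : (#|F|.-1)%:R = q - 1 by rewrite -subn1 natrB // ltnW // finNzRing_gt1.
have q1_neq0 : q - 1 != 0.
  by rewrite -q1 pnatr_eq0 -lt0n -subn1 subn_gt0 finNzRing_gt1.
have sBU : borel L n \subset ssunits L n.
  by apply/subsetP => x; apply: borel_units.
have -> : #|ssunits L n|%:R - #|borel L n|%:R =
    #|ssunits L n :\: borel L n|%:R :> C.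
  by rewrite cardsD (setIidPr sBU) natrB ?subset_leq_card.
rewrite (card_nonborel_Nrd i0 a0) natrM q1 mulrAC mulfV // mul1r natr_sum mulr_sumr.
apply: eq_bigr => x /andP[/setDP[xU _] /eqP <-].
by rewrite mulr1; have [yU <- <-] := chi_first_coord xU; rewrite etaE.
Qed.

End Characters.
End EtaleCharacters.

Theorem theorem1p10 (R : realType) (F : finFieldType) (psi : F -> R[i])
    (k : nat) (n d : 'I_k -> nat) (L : 'I_k -> fieldExtType F)
    (chis : forall i : 'I_k, finvect_type (L i) -> R[i])
    (chi : ssalg L n -> R[i]) (a : F) :
  additive_char psi -> (exists t, psi t != 1) ->
  (0 < k)%N -> (forall i, (0 < n i)%N) -> (forall i, \dim {:L i} = d i) ->
  ss_char chi -> det_type_with chis chi -> a != 0 ->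
  let q : nat := #|F| in
  let N : nat := (\sum_(i < k) d i * 'C(n i, 2))%N in
  let IKlM : R[i] := IKl psi a chi in
  let IKlB' : R[i] := IKl psi a (eta (n := n) chis) in
  let cardM : R[i] := #|ssunits L n|%:R in
  let cardBorel : R[i] := #|borel L n|%:R in
  let cardB' : R[i] := #|etale_units L n|%:R in
  let q_q1 : R[i] := q%:R * (q%:R - 1) in
  (~ trivial_on_ker_nu (eta (n := n) chis) -> IKlM = q%:R ^+ N * IKlB') /\
  (trivial_on_ker_nu (eta (n := n) chis) <->
     exists rho : F -> R[i], factors_through_nu (eta (n := n) chis) rho) /\
  (forall rho : F -> R[i], factors_through_nu (eta (n := n) chis) rho ->
     IKlM = q%:R ^+ N * IKlB' - rho a * ((cardM - cardBorel) / q_q1) /\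
     IKlM + rho a * (cardM / q_q1)
       = q%:R ^+ N * (IKlB' + rho a * (cardB' / q_q1))) /\
  #|borel L n| = (q ^ N * #|etale_units L n|)%N.
Proof.
move=> psiP psi_nt k0 n0 dimL _ [chisP chiP] a0.
move=> q N IKlM IKlB' cardM cardBorel cardB' q_q1.
have NE : (\sum_i \dim {:L i} * 'C(n i, 2))%N = N.
  by apply: eq_bigr => i _; rewrite dimL.
have i0 : 'I_k := Ordinal k0.
have borelE : #|borel L n| = (q ^ N * #|etale_units L n|)%N by rewrite card_borel NE.
have IKlE := IKl_borel chisP chiP psiP psi_nt a.
rewrite NE in IKlE.
split; [|split; [|split]] => //.
- by move=> ntriv; rewrite /IKlM IKlE (sum_nonborel_eq0 chisP chiP) // mulr0 subr0.
- exact: trivial_on_ker_nuP.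
move=> rho rhoP.
have part2 : IKlM = q%:R ^+ N * IKlB' - rho a * ((cardM - cardBorel) / q_q1).
  rewrite /IKlM IKlE (sum_nonborel_factor chisP n0 chiP i0 a0 rhoP).
  by rewrite /q_q1 invfM mulrCA [_^-1 * (_ / _)]mulrCA.
(* Substituting the order of the Borel subgroup cancels the terms in [cardM] and leaves [q ^ N] as a
   common factor. *)
split=> //; rewrite part2 /cardBorel borelE natrM natrX.
by rewrite -addrA mulrBl mulrBr opprB subrK mulrDr -mulrA (mulrCA (rho a)).
Qed.
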